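(* Let $G$ be a countable group which is not finitely generated. Then a generic element of $\Xi(G)$ is topologically $n$-transitive for all $n$; that is, the set of $\xi\in\Xi(G)$ which are topologically $n$-transitive for all $n$ is comeager in $\Xi(G)$.
   Context: $\Omega$ denotes the Cantor space; $\mathrm{Homeo}(\Omega)$ carries the uniform convergence topology. $\Xi(G)=\mathrm{Hom}(G,\mathrm{Homeo}(\Omega))$ is the Polish space of actions of the countable group $G$ on $\Omega$ by homeomorphisms, a closed subspace of $\mathrm{Homeo}(\Omega)^G$. An action of $G$ by homeomorphisms on a compact space $Z$ is topologically transitive if for all non-empty open $U,V\subseteq Z$ there is $g\in G$ with $g\cdot U\cap V\neq\emptyset$. It is topologically $n$-transitive if the diagonal action of $G$ on $Z^n$ is topologically transitive. *)

(* Defs.v *)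
From HB Require Import structures.
From mathcomp Require Import all_boot.
From mathcomp Require Import boolp classical_sets functions cardinality.
From mathcomp Require Import topology cantor.

Set Implicit Arguments.
Unset Strict Implicit.
Unset Printing Implicit Defensive.

Local Open Scope classical_set_scope.
Local Open Scope group_scope.

Definition finitely_generated (G : groupType) : Prop :=
  exists2 S : set G, finite_set S &
    smallest [set H : set G | group_closed (mem H)] S = [set: G].

Definition comeager (T : topologicalType) (A : set T) : Prop :=
  exists2 U : nat -> set T, (forall i, open (U i) /\ dense (U i)) &
    \bigcap_i U i `<=` A.

Definition homeomorphism (X Y : topologicalType) (f : X -> Y) : Prop :=
  exists g : Y -> X,
    [/\ cancel f g, cancel g f, continuous f & continuous g].

Definition homeo_set : set {uniform cantor_space -> cantor_space} :=
  [set f | homeomorphism (f : cantor_space -> cantor_space)].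

(* The topology induced on [set_type homeo_set] is that of uniform
   convergence. *)
Definition Homeo : Type := set_type homeo_set.

HB.instance Definition _ := Uniform.copy Homeo (set_type homeo_set).

Section HomeoGroup.
Implicit Types f g h : Homeo.

Definition homeo_fun f : cantor_space -> cantor_space := set_val f.

Lemma homeo_funP f : homeomorphism (homeo_fun f).
Proof. exact: set_valP. Qed.

Lemma homeo_eq f g : homeo_fun f =1 homeo_fun g -> f = g.
Proof. by move=> fg; apply/val_inj/funext. Qed.

Definition mk_homeo (f : cantor_space -> cantor_space)
    (hf : homeomorphism f) : Homeo :=
  exist _ (f : {uniform cantor_space -> cantor_space}) (mem_set hf).

Lemma homeo_one_subproof : homeomorphism (@id cantor_space).
Proof. by exists id; split=> // x; exact: cvg_id. Qed.

Lemma homeo_mul_subproof f g : homeomorphism (homeo_fun f \o homeo_fun g).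
Proof.
have [f' [fK f'K cf cf']] := homeo_funP f.
have [g' [gK g'K cg cg']] := homeo_funP g.
exists (g' \o f'); split; [exact: can_comp|exact: can_comp| |] => x.
- exact: (continuous_comp (cg x) (cf _)).
- exact: (continuous_comp (cf' x) (cg' _)).
Qed.

Definition homeo_inv_fun f : cantor_space -> cantor_space :=
  sval (cid (homeo_funP f)).

Lemma homeo_inv_subproof f : homeomorphism (homeo_inv_fun f).
Proof.
rewrite /homeo_inv_fun; case: (cid (homeo_funP f)) => g [fK gK cf cg] /=.
by exists (homeo_fun f).
Qed.

Definition homeo_one : Homeo := mk_homeo homeo_one_subproof.
Definition homeo_mul f g : Homeo := mk_homeo (homeo_mul_subproof f g).
Definition homeo_inv f : Homeo := mk_homeo (homeo_inv_subproof f).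

Lemma homeo_mulA : associative homeo_mul.
Proof. by move=> f g h; apply: homeo_eq. Qed.

Lemma homeo_1mul : left_id homeo_one homeo_mul.
Proof. by move=> f; apply: homeo_eq. Qed.

Lemma homeo_mul1 : right_id homeo_one homeo_mul.
Proof. by move=> f; apply: homeo_eq. Qed.

Lemma homeo_Vmul : left_inverse homeo_one homeo_inv homeo_mul.
Proof.
move=> f; apply: homeo_eq => x.
rewrite -[LHS]/(homeo_inv_fun f (homeo_fun f x)) /homeo_inv_fun.
by case: (cid (homeo_funP f)) => g [fK gK cf cg]; exact: fK.
Qed.

Lemma homeo_mulV : right_inverse homeo_one homeo_inv homeo_mul.
Proof.
move=> f; apply: homeo_eq => x.
rewrite -[LHS]/(homeo_fun f (homeo_inv_fun f x)) /homeo_inv_fun.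
by case: (cid (homeo_funP f)) => g [fK gK cf cg]; exact: gK.
Qed.

End HomeoGroup.

HB.instance Definition _ :=
  isGroup.Build Homeo homeo_mulA homeo_1mul homeo_mul1
    homeo_Vmul homeo_mulV.

Definition Xi_set (G : groupType) :
    set (prod_topology (fun _ : G => Homeo)) :=
  [set xi | monoid_morphism (xi : G -> Homeo)].
Arguments Xi_set : clear implicits.

Definition Xi (G : groupType) : Type := set_type (Xi_set G).

HB.instance Definition _ (G : groupType) :=
  Topological.copy (Xi G) (set_type (Xi_set G)).

Definition act_of (G : groupType) (xi : Xi G) (g : G) :
    cantor_space -> cantor_space :=
  homeo_fun (set_val xi g).

Definition topologically_transitive (G : groupType) (Z : topologicalType)
    (act : G -> Z -> Z) : Prop :=
  forall U V : set Z, open U -> open V -> U !=set0 -> V !=set0 ->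
    exists g : G, (act g @` U) `&` V !=set0.

Definition diagonal_action (G : groupType) (Z : Type) (n : nat)
    (act : G -> Z -> Z) (g : G) (z : prod_topology (fun _ : 'I_n => Z)) :
    prod_topology (fun _ : 'I_n => Z) :=
  fun i => act g (z i).

Definition topologically_n_transitive (G : groupType) (Z : topologicalType)
    (n : nat) (act : G -> Z -> Z) : Prop :=
  topologically_transitive (@diagonal_action G Z n act).

(* Main.v *)
Require Import Defs.
From mathcomp Require Import all_boot.
From mathcomp Require Import finmap.
From mathcomp Require Import boolp classical_sets functions cardinality.
From mathcomp Require Import topology filter cantor.

(** For a finite list [w] of pairs of finite binary words, let [moves w] be the
    set of actions for which a single group element [g] carries, for every pair
    [(s, t)] of [w] simultaneously, some point of the cylinder of [s] into the
    cylinder of [t]. There are countably many lists [w], products of cylinders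
    form a base of each power of the Cantor space, and hence an action lying in
    all the sets [moves w] is topologically n-transitive for every n. Each
    [moves w] is open because evaluating an action at a group element and a
    point is continuous ([moves_open]); the work lies in its density.

    Let an action [xi], a finite set [S] of group elements and a precision be
    given. The subgroup [H] generated by [S] is proper, as the group is not
    finitely generated. Coinduce the restriction of [xi] to [H] back to the
    whole group: the space of maps [f : G -> cantor_space] such that
    [f (a h) = xi (h^-1) (f a)] for [h] in [H], with [G] acting by left
    translation. Evaluation at 1 is an [H]-equivariant map from this space to
    the original one. Such an [f] is freely determined by its values on a set of
    representatives of the left cosets of [H], so the space of all [f] is again a
    countable power of [bool]; numbering its coordinates so that the first [N]
    ones are the first [N] coordinates of [f 1] turns the coinduced action into
    an action [eta] on the Cantor space itself, for which evaluation at 1 does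
    not change the first [N] coordinates. Consequently [eta h] is uniformly close
    to [xi h] for [h] in [S]. If [g] is not in [H], then 1 and [g^-1] lie in
    different cosets, so [f 1] and [f (g^-1)], which is the value at 1 of the
    translate of [f] by [g], can be prescribed independently: the element [g]
    moves any cylinder into any other, and [eta] is in [moves w]
    ([coinduced_action], [moves_approx]). *)

Set Implicit Arguments.
Unset Strict Implicit.
Unset Printing Implicit Defensive.

Local Open Scope classical_set_scope.
Local Open Scope group_scope.

(** * Agreement on initial coordinates *)

Definition agree (n : nat) (x y : cantor_space) : Prop :=
  forall k, (k < n)%N -> x k = y k.

Lemma agree_sym n x y : agree n x y -> agree n y x.
Proof. by move=> xy k /xy. Qed.

Lemma agree_trans n x y z : agree n x y -> agree n y z -> agree n x z.
Proof. by move=> xy yz k kn; rewrite xy // yz. Qed.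

Lemma agree_le m n x y : (m <= n)%N -> agree n x y -> agree m x y.
Proof. by move=> mn xy k km; apply: xy; exact: leq_trans mn. Qed.

(** Stated for filters, this replaces the description of a neighbourhood base of
    the product: the filter generated by a candidate base converges. *)
Lemma prod_topology_cvg (I : Type) (K : I -> topologicalType)
    (F : set_system (prod_topology K)) (u : prod_topology K) :
  Filter F ->
  (forall i A, nbhs (u i) A -> F [set z | A (z i)]) -> F --> u.
Proof.
move=> FF Fu; apply/cvg_sup => i U [V [[W oW <-] Wu WU]].
rewrite nbhs_filterE; apply: filterS WU _.
by apply: (Fu i W); exact: open_nbhs_nbhs.
Qed.

Lemma coord_near (x : cantor_space) k : \forall y \near x, x k = y k.
Proof.
have xk : nbhs (x k) [set b | x k = b].
  by rewrite nbhs_principalE; apply/principal_filterP.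
exact: (@proj_continuous nat (fun=> bool) k x _ xk).
Qed.

Lemma agree_near (x : cantor_space) n : \forall y \near x, agree n x y.
Proof.
have FF : Filter (nbhs x) := nbhs_filter x.
elim: n => [|n IH]; first by apply: filterE.
near=> y => k; rewrite ltnS leq_eqVlt => /predU1P[->|kn].
  by near: y; exact: coord_near.
by move: k kn; change (agree n x y); near: y.
Unshelve. all: by end_near. Qed.

Lemma agree_pow_filter n (u : 'I_n -> cantor_space) :
  Filter (filter_from setT (fun N =>
    [set z : prod_topology (fun _ : 'I_n => cantor_space) |
      forall i, agree N (u i) (z i)])).
Proof.
apply: filter_from_filter; first by exists 0%N.
move=> M N _ _; exists (maxn M N) => // z uz; split=> i;
  by apply: agree_le (uz i); rewrite ?leq_maxl ?leq_maxr.
Qed.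

(** A basic entourage of the product constrains finitely many coordinates, and
    the sum of their indices bounds all of them. *)
Lemma agree_entourage (E : set (cantor_space * cantor_space)) :
  entourage E -> exists N, forall x y, agree N x y -> E (x, y).
Proof.
move=> [D [F _ <-] FE].
suff [N NF] : exists N, forall p, p \in F -> ((projT1 p).1 < N)%N.
  exists N => x y xy; apply: FE => p pF.
  have /asboolP[B entB] := projT2 p; apply.
  change (B (x (sval p).1, y (sval p).1)).
  by rewrite xy ?NF //; exact: entourage_refl.
exists (\sum_(p <- F) (projT1 p).1).+1 => p pF; rewrite ltnS.
by rewrite (big_rem p) //= leq_addr.
Qed.

Lemma nbhs_agree (x : cantor_space) A :
  nbhs x A -> exists N, forall y, agree N x y -> A y.
Proof.
rewrite -nbhs_entourageE => -[E entE EA].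
have [N NE] := agree_entourage entE.
by exists N => y /NE xy; apply/EA/xsectionP.
Qed.

Lemma cvg_agree (T : Type) (F : set_system T) (f : T -> cantor_space) x :
  Filter F -> (forall n, \forall t \near F, agree n x (f t)) -> f @ F --> x.
Proof.
move=> FF fx A /nbhs_agree[N NA].
by apply: filterS (fx N) => t /NA.
Qed.

(** Uniform continuity on the compact Cantor space, proved by the near-covering
    form of compactness: around each point one modulus works locally. *)
Lemma continuous_agree_uniform (f : cantor_space -> cantor_space) m :
  continuous f -> exists n, forall x y, agree n x y -> agree m (f x) (f y).
Proof.
move=> cf.
have /compact_near_coveringP := cantor_space_compact.
move=> /(_ nat \oo (fun n x => forall y, agree n x y -> agree m (f x) (f y))).
case=> [x _|N _ Nf]; last by exists N => x; apply: (Nf N) => //=.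
have [N NA] : exists N, forall y, agree N x y -> agree m (f x) (f y).
  by apply: nbhs_agree; exact: (cf x _ (agree_near (f x) m)).
exists ([set y | agree N x y], [set n | (N <= n)%N]).
  by split; [exact: agree_near | exists N].
move=> [z n] /= [xz Nn] y zy.
apply: agree_trans (agree_sym (NA z xz)) (NA y _).
exact: agree_trans xz (agree_le Nn zy).
Qed.

Lemma nbhs_agree_pow n (u : prod_topology (fun _ : 'I_n => cantor_space)) A :
  nbhs u A -> exists N, forall z : prod_topology (fun _ : 'I_n => cantor_space),
    (forall i, agree N (u i) (z i)) -> A z.
Proof.
have FF := agree_pow_filter u.
suff: filter_from setT (fun N =>
    [set z : prod_topology (fun _ : 'I_n => cantor_space) |
      forall i, agree N (u i) (z i)]) --> u.
  by move=> Fu /Fu[N _ NA]; exists N => z /NA.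
apply: prod_topology_cvg => i B /nbhs_agree[N NB].
by exists N => // z uz; apply: NB.
Qed.

(** * Enumerations with a prescribed beginning *)

(** This is what lets a change of coordinates of the Cantor space fix the first
    coordinates: removing the prescribed elements on both sides leaves two
    countably infinite sets. *)
Lemma enum_prescribed (T : Type) (B : set T) (h : nat -> T) N :
  countable B -> infinite_set B -> injective h -> (forall k, B (h k)) ->
  exists b : nat -> T, exists i : T -> nat,
    [/\ cancel b i, forall n, B (b n), forall t, B t -> b (i t) = t &
        forall k, (k < N)%N -> b k = h k].
Proof.
elim/Ppointed: T => T in B h *; first by have := T (h 0%N).
move=> cB iB hI Bh.
have hbij : set_bij `I_N (h @` `I_N) h.
  by split=> // x y _ _ /hI.
have [f fh] := pPbij hbij.
have hB : h @` `I_N `<=` B by move=> _ [k _ <-].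
have fY : finite_set (h @` `I_N) by apply: finite_image; exact: finite_II.
have [|//||g gf] := @super_bij _ _ `I_N [set: nat] _ B f.
- by [].
- apply: (@card_eq_trans _ _ _ _ [set: nat]).
    apply: eq_card_nat => //.
    apply: infinite_setD; [exact: infinite_nat|exact: finite_II].
  apply/card_esym/eq_card_nat.
    by apply: sub_countable cB; apply: subset_card_le; exact: subDsetl.
  exact: infinite_setD.
have [s gs] := pPbij (@bij _ _ _ _ g).
exists s, (s^-1)%FUN; split.
- by move=> n; rewrite funK ?inE.
- by move=> n; exact: funS.
- by move=> t Bt; rewrite invK // inE.
- move=> k kN; rewrite -gs (gf k (mem_set kN)).
  exact: (congr1 (@^~ k) (esym fh)).
Qed.

(** * The space of actions *)

Lemma act_of1 (G : groupType) (xi : Xi G) x : act_of xi 1 x = x.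
Proof.
have [xi1 _] := set_valP xi.
by rewrite /act_of (xi1 : set_val xi 1 = 1 :> Homeo).
Qed.

Lemma act_ofM (G : groupType) (xi : Xi G) g h x :
  act_of xi (g * h) x = act_of xi g (act_of xi h x).
Proof.
have [_ xiM] := set_valP xi.
by rewrite /act_of
  (xiM g h : set_val xi (g * h) = set_val xi g * set_val xi h :> Homeo).
Qed.

Lemma act_of_continuous (G : groupType) (xi : Xi G) g :
  continuous (act_of xi g).
Proof. by rewrite /act_of; case: (homeo_funP (set_val xi g)) => f []. Qed.

Lemma Xi_of_action (G : groupType) (act : G -> cantor_space -> cantor_space) :
  (forall x, act 1 x = x) ->
  (forall g h x, act (g * h) x = act g (act h x)) ->
  (forall g, continuous (act g)) ->
  exists xi : Xi G, forall g, act_of xi g = act g.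
Proof.
move=> act1 actM actC.
have actH g : homeomorphism (act g).
  exists (act g^-1); split=> //.
  - by move=> x; rewrite -actM mulVg act1.
  - by move=> x; rewrite -actM mulgV act1.
pose phi : prod_topology (fun _ : G => Homeo) := fun g => mk_homeo (actH g).
have phiP : Xi_set G phi.
  split=> [|g h]; apply: homeo_eq => x.
    exact: act1.
  exact: actM.
by exists (exist _ phi (mem_set phiP)).
Qed.

Lemma eval_continuous_Xi (G : groupType) (g : G) (z : cantor_space) :
  continuous (fun xi : Xi G => act_of xi g z).
Proof.
move=> xi A Az.
pose W1 := [set f : {uniform cantor_space -> cantor_space} | A (f z)].
have nW1 : nbhs (homeo_fun (set_val xi g) :
    {uniform cantor_space -> cantor_space}) W1.
  apply/uniform_nbhs; move: Az; rewrite -nbhs_entourageE => -[E entE EA].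
  by exists E; split=> // h Eh; apply/EA/xsectionP/Eh.
pose W2 := [set f : Homeo | A (homeo_fun f z)].
have nW2 : nbhs (set_val xi g : Homeo) W2.
  exact: (@initial_continuous _ _ (set_val : homeo_set -> _) _ _ nW1).
have nW3 :=
  @proj_continuous G (fun=> Homeo : topologicalType) g (set_val xi) _ nW2.
exact: (@initial_continuous _ _ (set_val : Xi_set G -> _) _ _ nW3).
Qed.

(** Closeness is required for each group element separately, uniformly in the
    point: this is convergence in the product of the uniform topologies. *)
Lemma cvg_Xi (G : groupType) (F : set_system (Xi G)) (xi : Xi G) :
  Filter F ->
  (forall g n,
    F [set eta | forall z, agree n (act_of xi g z) (act_of eta g z)]) ->
  F --> xi.
Proof.
move=> FF Fxi A [_ [[W oW <-] Wxi WA]].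
rewrite nbhs_filterE; apply: filterS WA _.
suff : set_val @ F --> (set_val xi : prod_topology (fun _ : G => Homeo)).
  by apply; exact: open_nbhs_nbhs.
apply: prod_topology_cvg => g B [_ [[V oV <-] Vxi VB]].
suff : F [set eta | V (set_val (set_val eta g : Homeo))].
  move=> FV; change (F [set eta : Xi G | B (set_val eta g)]).
  by apply: filterS FV => eta; exact: (VB (set_val eta g)).
have /uniform_nbhs[E [entE EV]] : nbhs (homeo_fun (set_val xi g) :
    {uniform cantor_space -> cantor_space}) V.
  apply: open_nbhs_nbhs; split; [exact: oV | exact: Vxi].
have [n nE] := agree_entourage entE.
apply: filterS (Fxi g n) => eta xieta; apply: EV => z _.
exact: (nE _ _ (xieta z)).
Qed.

(** * Subgroups and representatives of their left cosets *)

Lemma subgroup1 (G : groupType) (H : set G) : group_closed (mem H) -> H 1.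
Proof. by move=> [+ _]; rewrite inE. Qed.

Lemma subgroupV (G : groupType) (H : set G) g :
  group_closed (mem H) -> H g -> H g^-1.
Proof. by move=> /group_closedV HV /mem_set/HV/set_mem. Qed.

Lemma subgroupM (G : groupType) (H : set G) g h :
  group_closed (mem H) -> H g -> H h -> H (g * h).
Proof.
by move=> /group_closedM HM /mem_set Hg /mem_set Hh; apply/set_mem/HM.
Qed.

Lemma smallest_subgroup (G : groupType) (S : set G) :
  group_closed (mem (smallest [set H : set G | group_closed (mem H)] S)).
Proof.
split=> [|g h /set_mem Sg /set_mem Sh]; apply/mem_set => H [Hcl SH].
  exact: subgroup1.
by apply: subgroupM => //; [exact: Sg|apply: subgroupV => //; exact: Sh].
Qed.

(** The map [r] sends an element to the chosen representative of its left coset;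
    the normalisation [r 1 = 1] makes the value at 1 of an equivariant map one
    of its free coordinates. *)
Definition coset_section (G : groupType) (H : set G) (r : G -> G) : Prop :=
  [/\ forall a, H (a^-1 * r a), forall a h, H h -> r (a * h) = r a & r 1 = 1].

Lemma coset_section_exists (G : groupType) (H : set G) :
  group_closed (mem H) -> exists r, coset_section H r.
Proof.
move=> Hcl.
pose r (a : G) := if `[< H a >] then 1 else xget 1 [set b | H (a^-1 * b)].
have HMr a h : H h -> H (a * h) <-> H a.
  move=> Hh; split=> [Hah|Ha]; last exact: subgroupM.
  by rewrite -(mulgK h a); apply: subgroupM => //; exact: subgroupV.
exists r; split.
- move=> a; rewrite /r; case: asboolP => [Ha|nHa].
    by rewrite mulg1; exact: subgroupV.
  apply: (xgetPex 1 (P := [set b | H (a^-1 * b)])).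
  by exists a; rewrite /= mulVg; exact: subgroup1.
- move=> a h Hh; rewrite /r (asbool_equiv_eq (HMr a h Hh)).
  case: asboolP => // _; congr xget; apply/seteqP; split=> b /=;
    rewrite invgM -mulgA.
    by move=> Hb; rewrite -(mulVKg h (a^-1 * b)); exact: subgroupM.
  by move=> Hb; apply: subgroupM => //; exact: subgroupV.
- by rewrite /r asboolT //; exact: subgroup1.
Qed.

Lemma coset_section_idem (G : groupType) (H : set G) (r : G -> G) a :
  coset_section H r -> r (r a) = r a.
Proof. by case=> Hr rH _; rewrite -{1}(mulVKg a (r a)) rH. Qed.

Lemma coset_section_neq1 (G : groupType) (H : set G) (r : G -> G) a :
  group_closed (mem H) -> coset_section H r -> ~ H a -> r a != 1.
Proof.
move=> Hcl [Hr _ _] nHa; apply/eqP => ra1; apply: nHa.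
by rewrite -(invgK a); apply: subgroupV => //; rewrite -(mulg1 a^-1) -ra1.
Qed.

(** * The coinduced action *)

(** The points of the coinduced space. *)
Definition equivariant (G : groupType) (H : set G) (xi : Xi G)
    (f : G -> cantor_space) : Prop :=
  forall a h, H h -> f (a * h) = act_of xi h^-1 (f a).

(** The equivariant map with values [w] on the representatives: [a] is the
    product of [r a] with the element [(a^-1 * r a)^-1] of the subgroup. *)
Definition extend_section (G : groupType) (xi : Xi G) (r : G -> G)
    (w : G -> cantor_space) (a : G) : cantor_space :=
  act_of xi (a^-1 * r a) (w (r a)).

Lemma extend_section_equivariant (G : groupType) (H : set G) (xi : Xi G) r w :
  coset_section H r -> equivariant H xi (extend_section xi r w).
Proof.
by case=> _ rH _ a h Hh; rewrite /extend_section rH // invgM -mulgA act_ofM.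
Qed.

Lemma extend_section_rep (G : groupType) (H : set G) (xi : Xi G) r w a :
  coset_section H r -> extend_section xi r w (r a) = w (r a).
Proof.
move=> rP; rewrite /extend_section (coset_section_idem _ rP) mulVg.
exact: act_of1.
Qed.

Lemma extend_sectionK (G : groupType) (H : set G) (xi : Xi G) r w f :
  coset_section H r -> equivariant H xi f -> (forall a, w (r a) = f (r a)) ->
  extend_section xi r w = f.
Proof.
move=> [Hr rH r1] fE wf; apply/funext => a; rewrite /extend_section wf.
rewrite -{2}(mulVKg a (r a)) fE // -act_ofM mulgV; exact: act_of1.
Qed.

(** The Cantor space in coinduced coordinates: [F x] is the equivariant map coded
    by the binary sequence [x] and [J] reads off the code. The coordinates are the
    pairs of a coset representative and a natural number, enumerated so that
    [(1, k)] comes at place [k] for [k < N]; this gives the last property. Each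
    bit of a code is a single bit of a single value of the map, hence the action
    transported through [F] and [J] is continuous. *)
Lemma coinduced_coordinates (G : groupType) (H : set G) (xi : Xi G) N :
  countable [set: G] -> group_closed (mem H) ->
  exists F : cantor_space -> G -> cantor_space,
  exists J : (G -> cantor_space) -> cantor_space,
    [/\ forall x, equivariant H xi (F x),
        cancel F J,
        forall f, equivariant H xi f -> F (J f) = f,
        forall a, continuous (F^~ a) &
        (forall n, exists a, exists k, forall f, J f n = f a k) /\
        (forall x, agree N x (F x 1))].
Proof.
move=> cG Hcl; have [r rP] := coset_section_exists Hcl.
have [Hr rH r1] := rP.
pose B := [set t : G * nat | r t.1 = t.1].
have B1 k : B (1, k) by [].
have cB : countable B.
  apply: (@sub_countable _ _ _ [set: G * nat]).
    exact: subset_card_le.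
  by rewrite -setXTT; apply: countableX.
have pair_inj : injective (fun k : nat => (1 : G, k)) by move=> j k [].
have iB : infinite_set B.
  move=> /(finite_preimage (in2W pair_inj)).
  have -> : (fun k => (1, k)) @^-1` B = [set: nat].
    by apply/seteqP; split=> // k _; exact: B1.
  exact: infinite_nat.
have [b [i [bi bB ib b1]]] := enum_prescribed N cB iB pair_inj B1.
pose e (x : cantor_space) (c : G) : cantor_space := fun k => x (i (c, k)).
pose F x := extend_section xi r (e x).
pose J (f : G -> cantor_space) : cantor_space := fun n => f (b n).1 (b n).2.
have Fr x a : F x (r a) = e x (r a) by exact: extend_section_rep rP.
exists F, J; split.
- by move=> x; exact: extend_section_equivariant.
- move=> x; apply/funext => n; rewrite /J -(bB n) Fr /e (bB n).
  by rewrite -surjective_pairing bi.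
- move=> f fE; apply: (extend_sectionK rP fE) => a.
  by apply/funext => k; rewrite /e /J ib //= /B /= (coset_section_idem _ rP).
- move=> a x; apply: (@continuous_comp _ _ _ (fun x => e x (r a))); last first.
    exact: act_of_continuous.
  apply: cvg_agree => m.
  have [n nP] : exists n, forall k, (k < m)%N -> (i (r a, k) < n)%N.
    exists (\sum_(k < m) i (r a, k : nat)).+1 => k km; rewrite ltnS.
    by rewrite (bigD1 (Ordinal km)) //= leq_addr.
  by apply: filterS (agree_near x n) => y xy k /nP/xy.
- split=> [n|x k kN]; first by exists (b n).1, (b n).2.
  by rewrite -[X in F _ X]r1 Fr r1 /e -b1 // bi.
Qed.

(** Here [p] is evaluation at 1. It is equivariant under the subgroup, it is close
    to the identity by the choice of coordinates, and outside the subgroup the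
    points [p x] and [p (act_of eta g x)] are independent of each other. *)
Lemma coinduced_action (G : groupType) (H : set G) (xi : Xi G) N :
  countable [set: G] -> group_closed (mem H) ->
  exists eta : Xi G, exists p : cantor_space -> cantor_space,
    [/\ forall x, agree N x (p x),
        forall h x, H h -> p (act_of eta h x) = act_of xi h (p x) &
        forall g u v, ~ H g -> exists x, p x = u /\ p (act_of eta g x) = v].
Proof.
move=> cG Hcl.
have [F [J [FE FK JK Fc [Jc FN]]]] := coinduced_coordinates xi N cG Hcl.
have shiftE g x : equivariant H xi (fun a => F x (g^-1 * a)).
  by move=> a h Hh; rewrite mulgA FE.
pose act g x := J (fun a => F x (g^-1 * a)).
have Fact g x a : F (act g x) a = F x (g^-1 * a) by rewrite JK.
have [eta etaE] : exists eta : Xi G, forall g, act_of eta g = act g.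
  apply: Xi_of_action => [x|g h x|g x].
  - rewrite -[RHS]FK; congr J; apply/funext => a.
    by rewrite invg1 mul1g.
  - by congr J; apply/funext => a; rewrite Fact invgM mulgA.
  - apply: prod_topology_cvg => n A An.
    have [a [k Jn]] := Jc n; rewrite /act Jn in An.
    have nA := @proj_continuous nat (fun=> bool) k _ _ An.
    have FF : Filter (nbhs x) := nbhs_filter x.
    change (nbhs x [set y | A (act g y n)]).
    have nB : nbhs x [set y | A (F y (g^-1 * a) k)].
      exact: Fc (g^-1 * a) x _ nA.
    apply: filterS nB => y.
    by rewrite /act /= Jn.
exists eta, (F^~ 1); split=> [//|h x Hh|g u v nHg].
  rewrite etaE Fact mulg1 -[h^-1]mul1g FE ?invgK //.
  exact: subgroupV.
have [r rP] := coset_section_exists Hcl.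
have nHVg : ~ H g^-1 by move=> /(subgroupV Hcl); rewrite invgK.
have rg1 := coset_section_neq1 Hcl rP nHVg.
(* The value at [g^-1] is transported to the representative of its coset, which
   differs from 1. *)
pose w (a : G) := if a == 1 then u else act_of xi (g * r g^-1)^-1 v.
exists (J (extend_section xi r w)).
have fE := extend_section_equivariant xi w rP.
rewrite etaE Fact JK // mulg1; split.
  have [_ _ r1] := rP.
  by rewrite /extend_section r1 mulg1 invg1 act_of1 /w eqxx.
rewrite /extend_section /w (negbTE rg1) invgK -act_ofM mulgV.
exact: act_of1.
Qed.

(** * The open dense sets *)

Definition cylinder (s : seq bool) : set cantor_space :=
  [set x | forall k, (k < size s)%N -> x k = nth false s k].

Lemma cylinder_agree s n x y :
  (size s <= n)%N -> agree n x y -> cylinder s x -> cylinder s y.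
Proof. by move=> sn xy sx k ks; rewrite -xy ?sx //; exact: leq_trans sn. Qed.

Lemma cylinder_mkseq (x y : cantor_space) n :
  cylinder (mkseq x n) y -> agree n x y.
Proof. by move=> xy k kn; rewrite xy ?size_mkseq // nth_mkseq. Qed.

(** One element [g] must serve all pairs of [w]: the pairs are the coordinates of
    a power of the Cantor space. Using words rather than open sets leaves only
    countably many such sets. *)
Definition moves (G : groupType) (w : seq (seq bool * seq bool)) : set (Xi G) :=
  [set xi | exists g, forall c, c \in w ->
    exists2 z, cylinder c.1 z & cylinder c.2 (act_of xi g z)].

Lemma moves_open (G : groupType) w : open (@moves G w).
Proof.
rewrite openE => xi [g gw].
have FF : Filter (nbhs xi) := nbhs_filter xi.
suff nw : \forall eta \near xi, forall c, c \in w ->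
    exists2 z, cylinder c.1 z & cylinder c.2 (act_of eta g z).
  by apply: filterS nw => eta etaw; exists g.
elim: w gw => [|c w IH] gw; first by apply: filterE.
have [z z1 z2] := gw c (mem_head c w).
have nc : \forall eta \near xi, cylinder c.2 (act_of eta g z).
  have nz : nbhs xi
      [set eta | agree (size c.2) (act_of xi g z) (act_of eta g z)].
    exact: (eval_continuous_Xi (agree_near (act_of xi g z) (size c.2))).
  by apply: filterS nz => eta /cylinder_agree; apply.
have nw := IH (fun d dw => gw d (mem_behead (s := c :: w) dw)).
apply: filterS2 nc nw => eta etac etaw d.
by rewrite inE => /predU1P[->|/etaw //]; exists z.
Qed.

Lemma not_fg_proper (G : groupType) (S : set G) :
  ~ finitely_generated G -> finite_set S ->
  exists2 H : set G, group_closed (mem H) /\ S `<=` H & exists g, ~ H g.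
Proof.
move=> nfg finS.
exists (smallest [set H : set G | group_closed (mem H)] S).
  by split; [exact: smallest_subgroup | exact: sub_gen_smallest].
apply/existsNP => Sall; apply: nfg; exists S => //.
by apply/seteqP; split=> // g _; exact: Sall.
Qed.

Lemma uniform_modulus (G : groupType) (xi : Xi G) (S : set G) n :
  finite_set S -> exists N, forall g, S g ->
    forall x y, agree N x y -> agree n (act_of xi g x) (act_of xi g y).
Proof.
move=> finS.
have /choice[m mP] := fun g =>
  continuous_agree_uniform n (act_of_continuous (xi := xi) (g := g)).
have [s sS] := (finite_seqP S).1 finS.
exists (\sum_(g <- s) m g) => g; rewrite sS /= => gs x y xy.
by apply: mP; apply: agree_le xy; rewrite (big_rem g) //= leq_addr.
Qed.

(** The precision [N] is at least [n] and at least a modulus of continuity of [xi]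
    on [S], so that [xi h z], then [xi h (p z)], which is [p (eta h z)], and finally
    [eta h z] agree up to [n]. It is also at least the length of each word of [w],
    so that [p] respects the cylinders of [w]. *)
Lemma moves_approx (G : groupType) (xi : Xi G) (S : set G) n w :
  countable [set: G] -> ~ finitely_generated G -> finite_set S ->
  exists2 eta, moves w eta &
    forall g, S g -> forall z, agree n (act_of xi g z) (act_of eta g z).
Proof.
move=> cG nfg finS.
have [H [Hcl SH] [g nHg]] := not_fg_proper nfg finS.
have [M MP] := uniform_modulus xi n finS.
pose L := \sum_(c <- w) (size c.1 + size c.2).
have wL c : c \in w -> (size c.1 <= L)%N /\ (size c.2 <= L)%N.
  move=> cw; rewrite /L (big_rem c) //=; split.
    by rewrite -addnA leq_addr.
  by rewrite addnAC leq_addl.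
pose N := (n + M + L)%N.
have [eta [p [pN pH pg]]] := coinduced_action xi N cG Hcl.
have nN : (n <= N)%N by rewrite /N -addnA leq_addr.
have MN : (M <= N)%N by rewrite /N addnAC leq_addl.
have LN : (L <= N)%N by rewrite /N leq_addl.
exists eta.
  exists g => c /wL[c1 c2].
  have [x [pu pv]] := pg g (nth false c.1) (nth false c.2) nHg.
  exists x.
    apply: (cylinder_agree (leq_trans c1 LN) (agree_sym (pN x))).
    by rewrite pu.
  apply: (cylinder_agree (leq_trans c2 LN) (agree_sym (pN _))).
  by rewrite pv.
move=> h Sh z; apply: (@agree_trans _ _ (act_of xi h (p z))).
  by apply: MP => //; exact: agree_le (pN z).
rewrite -pH; last exact: SH.
exact: agree_sym (agree_le nN (pN _)).
Qed.

(** Enumerating the group gives an increasing exhaustion by finite sets; the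
    approximations for these sets converge to [xi]. *)
Lemma moves_dense (G : groupType) w :
  countable [set: G] -> ~ finitely_generated G -> dense (@moves G w).
Proof.
move=> cG nfg O [xi Oxi] oO.
have [code codeI] := countable_injP _ cG.
have finS n : finite_set [set g : G | (code g < n)%N].
  apply: (@finite_preimage _ _ `I_n code); last exact: finite_II.
  by move=> g h _ _; apply: codeI; rewrite inE.
have /choice[eta etaP] : forall n, exists eta, moves w eta /\
    forall g, (code g < n)%N ->
      forall z, agree n (act_of xi g z) (act_of eta g z).
  by move=> n; have [eta] := moves_approx xi n w cG nfg (finS n); exists eta.
have eta_xi : eta @ \oo --> xi.
  apply: cvg_Xi => g n; exists (maxn n (code g).+1) => // m /=.
  rewrite geq_max => /andP[nm gm] z.
  by apply: agree_le nm _; apply: (etaP m).2.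
have [N _ NO] := eta_xi O (open_nbhs_nbhs (conj oO Oxi)).
by exists (eta N); split; [exact: (NO N (leqnn N)) | exact: (etaP N).1].
Qed.

(** A pair of basic open sets of the n-th power is a list of n pairs of words, one
    for each coordinate. *)
Lemma moves_n_transitive (G : groupType) (xi : Xi G) n :
  (forall w, moves w xi) -> topologically_n_transitive n (act_of xi).
Proof.
move=> xiw U V oU oV [u Uu] [v Vv].
have [M MU] := nbhs_agree_pow (open_nbhs_nbhs (conj oU Uu)).
have [N NV] := nbhs_agree_pow (open_nbhs_nbhs (conj oV Vv)).
have [g gw] := xiw [seq (mkseq (u i) M, mkseq (v i) N) | i <- enum 'I_n].
have /choice[z zP] : forall i : 'I_n, exists z,
    agree M (u i) z /\ agree N (v i) (act_of xi g z).
  move=> i.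
  have [|z z1 z2] := gw (mkseq (u i) M, mkseq (v i) N).
    by apply/mapP; exists i; rewrite ?mem_enum.
  by exists z; split; exact: cylinder_mkseq.
exists g, (fun i => act_of xi g (z i)); split.
  by exists z => //; apply: MU => i; exact: (zP i).1.
by apply: NV => i; exact: (zP i).2.
Qed.

Theorem proposition7p4 (G : groupType) (G_countable : countable [set: G])
    (G_not_fg : ~ finitely_generated G) :
  comeager [set xi : Xi G |
    forall n : nat, topologically_n_transitive n (act_of xi)].
Proof.
pose W := seq (seq bool * seq bool).
exists (fun i : nat => moves (odflt [::] (choice.unpickle i : option W)))
  => [i|xi xiU n].
  by split; [exact: moves_open | exact: moves_dense].
apply: moves_n_transitive => w.
by have := xiU (choice.pickle w) I; rewrite choice.pickleK.
Qed.
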